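(* Let $A$ be a Banach algebra, $\eta$ an infinite cardinal and $X_1,\dots,X_m$ subsets of $LUC(A)^*$, each of cardinality at least $\eta$. Suppose that $A$ has the $\eta$-Mazur property and that $A^*$ has the $\eta$-factorization property through $\prod_{k=1}^m X_k$. Let $X=\bigcup_{k=1}^m X_k$, and let $\widetilde X\subseteq A^{**}$ be a set consisting of one fixed norm-preserving extension $\widetilde\Psi\in A^{**}$ (i.e. $\widetilde\Psi|_{LUC(A)}=\Psi$ and $\|\widetilde\Psi\|=\|\Psi\|$) for each $\Psi\in X$. Then: (1) for every weak$^*$-closed subsemigroup $\mathscr S$ of $A^{**}$ (with the first Arens product) with $\widetilde X\subseteq\mathscr S$, one has $T_1Z(\mathscr S)=\mathscr S\cap A$; (2) in particular $T_1Z(A^{**})=A$, that is, $A$ is left strongly Arens irregular.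
   Context: Module actions. For a Banach algebra $A$, $S\in A^*$, $a,b\in A$, $\Phi,\Psi\in A^{**}$: $\langle S\cdot a,b\rangle=\langle S,ab\rangle$, $\langle \Psi\cdot S,a\rangle=\langle\Psi,S\cdot a\rangle$, and the first Arens product on $A^{**}$ is $\langle\Phi\Psi,S\rangle=\langle\Phi,\Psi\cdot S\rangle$. $A$ is regarded as a subalgebra of $A^{**}$. $LUC(A)$ is the closed linear span of $A^*\cdot A=\{S\cdot a\}$ in $A^*$. $LUC(A)^*$ acts on $A^*$ by $\langle\Psi\cdot S,a\rangle=\langle\Psi,S\cdot a\rangle$ ($\Psi\in LUC(A)^*$, $S\in A^*$, $a\in A$). Topological centre. For a subsemigroup $\mathscr S$ of $A^{**}$, $T_1Z(\mathscr S)$ is the set of $\Psi\in\mathscr S$ such that $\Phi\mapsto\Psi\Phi$, $\mathscr S\to\mathscr S$, is weak$^*$-weak$^*$-continuous. $\eta$-factorization property. $A^*$ has the $\eta$-factorization property through $\prod_{k=1}^mX_k$ if for every bounded family $\{S_\lambda:\lambda<\eta\}$ in $A^*$ there exist a bounded family $\{(\Psi_{\lambda k})_{k=1}^m:\lambda<\eta\}$ in $\prod_{k=1}^mX_k$ and functionals $T_1,\dots,T_m\in A^*$ such that $S_\lambda=\sum_{k=1}^m\Psi_{\lambda k}\cdot T_k$ for all $\lambda<\eta$. $\eta$-Mazur property. For a Banach space $E$, a functional $\Psi\in E^{**}$ is $\eta$-weak$^*$-continuous if for every infinite net $(S_\lambda)_\lambda$ in the unit ball of $E^*$ of cardinality at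 most $\eta$ with $S_\lambda\to0$ weak$^*$, one has $\langle\Psi,S_\lambda\rangle\to0$. $E$ has the $\eta$-Mazur property if every $\eta$-weak$^*$-continuous $\Psi\in E^{**}$ belongs to $E$. *)

(* Defs.v *)
From HB Require Import structures.
From mathcomp Require Import all_boot all_order all_algebra.
From mathcomp Require Import complex.
From mathcomp Require Import all_classical all_reals.
From mathcomp Require Import topology normedtype.

Set Implicit Arguments.
Unset Strict Implicit.
Unset Printing Implicit Defensive.

Import Order.TTheory GRing.Theory Num.Theory.
Import numFieldNormedType.Exports.

Local Open Scope classical_set_scope.
Local Open Scope ring_scope.

Variant scalar_kind := real_scalars | complex_scalars.

Definition scalars (R : realType) (k : scalar_kind) : numFieldType :=
  match k with
  | real_scalars => R
  | complex_scalars => complex R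
  end.

Definition of_real (R : realType) (k : scalar_kind) : R -> scalars R k :=
  match k return R -> scalars R k with
  | real_scalars => fun x => x
  | complex_scalars => fun x => Complex x 0
  end.

Definition to_real (R : realType) (k : scalar_kind) : scalars R k -> R :=
  match k return scalars R k -> R with
  | real_scalars => fun x => x
  | complex_scalars => fun z => complex.Re z
  end.

Section scalars_theory.
Context (R : realType) (k : scalar_kind).
Implicit Types (x y : scalars R k) (r s : R).

Lemma of_realK r : to_real (of_real k r) = r.
Proof. by case: k. Qed.

Lemma to_realK x : 0 <= x -> of_real k (to_real x) = x.
Proof.
by move: x; case: k => //= -[a b]; rewrite lecE /= => /andP[/eqP <-].
Qed.

Lemma ler_of_real r s : (of_real k r <= of_real k s) = (r <= s).
Proof. by case: k => //=; rewrite lecE /= eqxx. Qed.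

Lemma of_real0 : of_real k (0 : R) = 0.
Proof. by case: k. Qed.

Lemma ler_to_real x y : 0 <= x -> 0 <= y -> (to_real x <= to_real y) = (x <= y).
Proof. by move=> x0 y0; rewrite -ler_of_real !to_realK. Qed.

End scalars_theory.

Section dual.
Context (R : realType) (k : scalar_kind).
Local Notation K := (scalars R k).
Variable E : normedModType K.

Definition dual_pred : {pred E -> K^o} :=
  mem [set f : E -> K^o | linear f /\ continuous f].

Lemma dual_submod_closed : submod_closed dual_pred.
Proof.
split=> [|a f g]; rewrite !inE /=.
  split=> [a x y /=|]; first by rewrite scaler0 addr0.
  exact: cst_continuous.
move=> [lf cf] [lg cg]; split=> [b x y|x].
  rewrite /= !fctE lf lg /= !scalerDr !scalerA (mulrC a b) addrACA.
  by congr (_ + _ + _); rewrite scalerDr scalerA.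
apply: cvgD; last exact: cg.
by apply: cvgZr; exact: cf.
Qed.

HB.instance Definition _ := GRing.isSubmodClosed.Build _ _ dual_pred
  dual_submod_closed.

Record dual : Type := Dual {
  dual_fun :> E -> K^o;
  dual_funP : dual_fun \in dual_pred
}.

HB.instance Definition _ := [isSub for dual_fun].
HB.instance Definition _ := [Choice of dual by <:].
HB.instance Definition _ := [SubChoice_isSubLmodule of dual by <:].

Lemma dual_linear (f : dual) : linear f.
Proof. by case: f => f /=; rewrite inE => -[]. Qed.

Lemma dual_continuous (f : dual) : continuous f.
Proof. by case: f => f /=; rewrite inE => -[]. Qed.

HB.instance Definition _ (f : dual) :=
  GRing.isLinear.Build K E K^o _ f (@dual_linear f).

Lemma dualP (f g : dual) : f =1 g -> f = g.
Proof. by move=> fg; apply/val_inj/funext. Qed.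

Lemma dualD (f g : dual) (x : E) : (f + g) x = f x + g x.
Proof. by []. Qed.

Lemma dualZ (a : K) (f : dual) (x : E) : (a *: f) x = a * f x.
Proof. by []. Qed.

(* Norms of normed modules over K take their values in K, hence [of_real]. *)
Definition dual_norm (f : dual) : K :=
  of_real k (sup [set to_real `|f x| | x in [set x : E | `|x| <= 1]]).

Lemma dual_bounded (f : dual) : exists2 M : K, 0 <= M &
  forall x, `|f x| <= M * `|x|.
Proof.
have /linear_boundedP : bounded_near f (nbhs (0 : E)).
  by apply: continuous_linear_bounded; exact: dual_continuous.
move=> /pinfty_ex_gt0[M M0 fM]; exists M => //; exact: ltW.
Qed.

Let S (f : dual) := [set to_real `|f x| | x in [set x : E | `|x| <= 1]].

Let has_supS f : has_sup (S f).
Proof.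
split; first by exists (to_real `|f 0|), 0 => //=; rewrite normr0.
have [M M0 fM] := dual_bounded f; exists (to_real M) => _ [x /= x1 <-].
by rewrite ler_to_real// (le_trans (fM x))// ler_piMr.
Qed.

Lemma dual_norm_ge0 f : 0 <= dual_norm f.
Proof.
rewrite -(of_real0) ler_of_real.
apply: sup_upper_bound; first exact: has_supS.
exists 0 => /=; first by rewrite normr0.
by rewrite linear0 normr0 -[X in to_real X]of_real0 of_realK.
Qed.

Lemma ler_dual_norm (f : dual) (x : E) : `|f x| <= dual_norm f * `|x|.
Proof.
have [->|x0] := eqVneq x 0; first by rewrite linear0 !normr0 mulr0.
have nx0 : 0 < `|x| by rewrite normr_gt0.
rewrite -ler_pdivrMr// -(normr_id x) -normfV mulrC -normrM.
have -> : (`|x|^-1 * f x) = f (`|x|^-1 *: x) by rewrite linearZ.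
rewrite -(to_realK (normr_ge0 (f _))) ler_of_real.
apply: sup_upper_bound; first exact: has_supS.
by exists (`|x|^-1 *: x) => //=; rewrite normfZV.
Qed.

Lemma dual_norm_le (f : dual) (M : K) : 0 <= M -> (forall x, `|f x| <= M * `|x|) ->
  dual_norm f <= M.
Proof.
move=> M0 fM; rewrite -(to_realK M0) ler_of_real.
apply: ge_sup; first by case: (has_supS f).
by move=> _ [x /= x1 <-]; rewrite ler_to_real// (le_trans (fM x))// ler_piMr.
Qed.

Lemma ler_dual_normD f g : dual_norm (f + g) <= dual_norm f + dual_norm g.
Proof.
apply: dual_norm_le => [|x]; first by rewrite addr_ge0 ?dual_norm_ge0.
by rewrite dualD mulrDl (le_trans (ler_normD _ _))// lerD ?ler_dual_norm.
Qed.

Lemma dual_normZ (a : K) f : dual_norm (a *: f) = `|a| * dual_norm f.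
Proof.
have le b h : dual_norm (b *: h) <= `|b| * dual_norm h.
  apply: dual_norm_le => [|x]; first by rewrite mulr_ge0 ?dual_norm_ge0.
  by rewrite dualZ normrM -mulrA ler_wpM2l// ler_dual_norm.
apply/le_anti; rewrite le/=.
have [->|a0] := eqVneq a 0; first by rewrite normr0 mul0r dual_norm_ge0.
rewrite -ler_pdivlMl ?normr_gt0// -normfV.
by rewrite -{1}(scalerK a0 f) le.
Qed.

Lemma dual_norm0_eq0 f : dual_norm f = 0 -> f = 0.
Proof.
move=> f0; apply: dualP => x; apply/eqP; rewrite -normr_le0.
by rewrite (le_trans (ler_dual_norm f x))// f0 mul0r.
Qed.

HB.instance Definition _ :=
  Lmodule_isNormed.Build K dual ler_dual_normD dual_normZ dual_norm0_eq0.

Lemma ler_norm_dual (f : dual) (x : E) : `|f x| <= `|f| * `|x|.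
Proof. exact: ler_dual_norm. Qed.

Lemma norm_dual_le (f : dual) (M : K) : 0 <= M ->
  (forall x, `|f x| <= M * `|x|) -> `|f| <= M.
Proof. exact: dual_norm_le. Qed.

Lemma bounded_linear_dual (f : E -> K^o) (M : K) :
  linear f -> (forall x, `|f x| <= M * `|x|) -> f \in dual_pred.
Proof.
move=> lf fM; rewrite inE; split=> //.
pose F : {linear E -> K^o} := HB.pack f (GRing.isLinear.Build _ _ _ _ _ lf).
apply: (@bounded_linear_continuous _ _ _ F); apply/linear_boundedP.
exists `|M|; split => [|r Mr x]; first exact: normr_real.
have Mx0 : 0 <= M * `|x| by exact: le_trans (fM x).
rewrite (le_trans (fM x))// -(ger0_norm Mx0) normrM normr_id ler_wpM2r//.
exact: ltW.
Qed.

End dual.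

Arguments dual_pred {R k} E.

Section closed_span.
Context (K : numFieldType) (E : normedModType K).

Definition linear_span (B : set E) : set E :=
  [set x | exists2 s : seq (K * E),
    (forall p, p \in s -> B p.2) & x = \sum_(p <- s) p.1 *: p.2].

Definition closed_linear_span (B : set E) : set E := closure (linear_span B).

Definition closed_span_pred (B : set E) : {pred E} :=
  mem (closed_linear_span B).

Lemma linear_span_comb B (a : K) x y :
  linear_span B x -> linear_span B y -> linear_span B (a *: x + y).
Proof.
move=> [s sB ->] [t tB ->].
exists ([seq (a * p.1, p.2) | p <- s] ++ t) => [p|].
  by rewrite mem_cat => /orP[/mapP[q /sB qB ->]|/tB].
rewrite big_cat /= big_map scaler_sumr; congr (_ + _).
by apply: eq_bigr => p _; rewrite scalerA.
Qed.

Lemma sub_closed_linear_span B : B `<=` closed_linear_span B.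
Proof.
move=> x Bx; apply: subset_closure; exists [:: (1, x)] => [p|].
  by rewrite inE => /eqP ->.
by rewrite big_seq1 scale1r.
Qed.

Lemma closed_span_submod_closed B : submod_closed (closed_span_pred B).
Proof.
split=> [|a x y]; rewrite !inE.
  by apply: subset_closure; exists [::]; rewrite ?big_nil.
move=> xB yB U nU.
have : (fun z : E * E => a *: z.1 + z.2) @ (x, y) --> a *: x + y.
  apply: (@cvgD _ _ _ (nbhs (x, y))); last exact: cvg_snd.
  by apply: cvgZr; exact: cvg_fst.
move=> /(_ U nU)[[P Q] /= [nP nQ] PQU].
have [u [uB Pu]] := xB P nP; have [v [vB Qv]] := yB Q nQ.
exists (a *: u + v); split; first exact: linear_span_comb.
exact: (PQU (u, v)).
Qed.

HB.instance Definition _ B := GRing.isSubmodClosed.Build _ _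
  (closed_span_pred B) (@closed_span_submod_closed B).

Record closed_span (B : set E) : Type := ClosedSpan {
  closed_span_val :> E;
  closed_spanP : closed_span_val \in closed_span_pred B
}.

Section instances.
Variable B : set E.

HB.instance Definition _ := [isSub for @closed_span_val B].
HB.instance Definition _ := [Choice of closed_span B by <:].
HB.instance Definition _ := [SubChoice_isSubLmodule of closed_span B by <:].

Lemma closed_span_normD (x y : closed_span B) :
  `|val (x + y)| <= `|val x| + `|val y|.
Proof. exact: ler_normD. Qed.

Lemma closed_span_normZ (a : K) (x : closed_span B) :
  `|val (a *: x)| = `|a| * `|val x|.
Proof. exact: normrZ. Qed.

Lemma closed_span_norm0 (x : closed_span B) : `|val x| = 0 -> x = 0.
Proof. by move=> /eqP; rewrite normr_eq0 => /eqP x0; apply: val_inj. Qed.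

HB.instance Definition _ := Lmodule_isNormed.Build K (closed_span B)
  closed_span_normD closed_span_normZ closed_span_norm0.

End instances.

Definition to_closed_span (B : set E) (x : E) (Bx : B x) : closed_span B :=
  ClosedSpan (mem_set (sub_closed_linear_span Bx)).

End closed_span.

(* The algebras are not assumed to be unital. *)
HB.mixin Record isBanachAlgebra (K : numFieldType) (A : Type)
    & CompleteNormedModule K A := {
  bmul : A -> A -> A;
  bmulA : associative bmul;
  bmulDl : left_distributive bmul +%R;
  bmulDr : right_distributive bmul +%R;
  bmulZl : forall (c : K) (a b : A), bmul (c *: a) b = c *: bmul a b;
  bmulZr : forall (c : K) (a b : A), bmul a (c *: b) = c *: bmul a b;
  ler_norm_bmul : forall a b : A, `|bmul a b| <= `|a| * `|b|
}.

#[short(type="banachAlgType")]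
HB.structure Definition BanachAlgebra (K : numFieldType) :=
  {A of CompleteNormedModule K A & isBanachAlgebra K A}.

Section bidual.
Context (R : realType) (k : scalar_kind).
Local Notation K := (scalars R k).

Fact bidual_subproof (E : normedModType K) (x : E) :
  (fun f : dual E => f x) \in dual_pred (dual E).
Proof.
apply: (@bounded_linear_dual _ _ _ _ `|x|) => // f.
by rewrite mulrC ler_norm_dual.
Qed.

Definition to_bidual (E : normedModType K) (x : E) : dual (dual E) :=
  Dual (bidual_subproof x).

(* The weak* topology lives on the dual of [E], not on [E]. *)
Definition weak_star (E : normedModType K) : Type :=
  initial_topology (fun f : dual E => (f : {ptws E -> K})).

HB.instance Definition _ (E : normedModType K) :=
  Topological.copy (weak_star E)
    (initial_topology (fun f : dual E => (f : {ptws E -> K}))).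

End bidual.

Section arens.
Context (R : realType) (k : scalar_kind).
Local Notation K := (scalars R k).
Variable A : banachAlgType K.

Fact dual_act_subproof (S : dual A) (a : A) :
  (fun b => S (bmul a b)) \in dual_pred A.
Proof.
apply: (@bounded_linear_dual _ _ _ _ (`|S| * `|a|)) => [c x y|b].
  by rewrite bmulDr bmulZr linearP.
rewrite -mulrA (le_trans (ler_norm_dual _ _))//.
by rewrite ler_wpM2l// ler_norm_bmul.
Qed.

Definition dual_act (S : dual A) (a : A) : dual A :=
  Dual (dual_act_subproof S a).

Lemma dual_act_linear (S : dual A) : linear (dual_act S).
Proof.
by move=> c x y; apply: dualP => b; rewrite dualD dualZ /= bmulDl bmulZl linearP.
Qed.

Lemma ler_norm_dual_act (S : dual A) (a : A) : `|dual_act S a| <= `|S| * `|a|.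
Proof.
apply: norm_dual_le => [|b]; first exact: mulr_ge0.
rewrite -mulrA (le_trans (ler_norm_dual S _))//.
by rewrite ler_wpM2l// ler_norm_bmul.
Qed.

Fact bidual_act_subproof (Psi : dual (dual A)) (S : dual A) :
  (fun a => Psi (dual_act S a)) \in dual_pred A.
Proof.
apply: (@bounded_linear_dual _ _ _ _ (`|Psi| * `|S|)) => [c x y|a].
  by rewrite dual_act_linear linearP.
rewrite -mulrA (le_trans (ler_norm_dual Psi _))// ler_wpM2l//.
exact: ler_norm_dual_act.
Qed.

Definition bidual_act (Psi : dual (dual A)) (S : dual A) : dual A :=
  Dual (bidual_act_subproof Psi S).

Fact arens_subproof (Phi Psi : dual (dual A)) :
  (fun S => Phi (bidual_act Psi S)) \in dual_pred (dual A).
Proof.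
apply: (@bounded_linear_dual _ _ _ _ (`|Phi| * `|Psi|)) => [c S T|S].
  rewrite -linearP; congr (Phi _); apply: dualP => a.
  rewrite -[RHS]/(c *: Psi (dual_act S a) + Psi (dual_act T a)) -linearP.
  by congr (Psi _); exact: dualP.
rewrite -mulrA (le_trans (ler_norm_dual Phi _))// ler_wpM2l//.
apply: norm_dual_le => [|a]; first exact: mulr_ge0.
rewrite -mulrA (le_trans (ler_norm_dual Psi _))// ler_wpM2l//.
exact: ler_norm_dual_act.
Qed.

Definition first_arens (Phi Psi : dual (dual A)) : dual (dual A) :=
  Dual (arens_subproof Phi Psi).

Definition first_arens_subsemigroup (S : set (dual (dual A))) : Prop :=
  forall Phi Psi, S Phi -> S Psi -> S (first_arens Phi Psi).

Definition T1Z (S : set (dual (dual A))) : set (dual (dual A)) :=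
  [set Psi | S Psi /\
    {within (S : set (weak_star (dual A))),
      continuous (first_arens Psi : weak_star (dual A) -> weak_star (dual A))}].

Definition left_strongly_Arens_irregular : Prop :=
  T1Z [set: dual (dual A)] = range (@to_bidual R k A).

Definition LUC_generators : set (dual A) :=
  [set dual_act S a | S in [set: dual A] & a in [set: A]].

Fact LUC_generatorsP (S : dual A) (a : A) : LUC_generators (dual_act S a).
Proof. by exists S => //; exists a. Qed.

Definition LUC : Type := closed_span LUC_generators.

Definition LUC_act_pt (S : dual A) (a : A) : LUC :=
  to_closed_span (LUC_generatorsP S a).

Fact LUC_dual_act_subproof (Psi : dual LUC) (S : dual A) :
  (fun a => Psi (LUC_act_pt S a)) \in dual_pred A.
Proof.
apply: (@bounded_linear_dual _ _ _ _ (`|Psi| * `|S|)) => [c x y|a].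
  by rewrite -linearP; congr (Psi _); apply: val_inj; exact: dual_act_linear.
rewrite -mulrA (le_trans (ler_norm_dual Psi _))// ler_wpM2l//.
exact: ler_norm_dual_act.
Qed.

Definition LUC_dual_act (Psi : dual LUC) (S : dual A) : dual A :=
  Dual (LUC_dual_act_subproof Psi S).

End arens.

(* A cardinal is represented by a type [H], and a family indexed by the
   ordinals below it by a function on [H]. *)
Definition factorization_property (R : realType) (k : scalar_kind)
    (A : banachAlgType (scalars R k)) (H : Type) (m : nat)
    (X : 'I_m -> set (dual (LUC A))) : Prop :=
  forall S : H -> dual A, bounded_fun S ->
  exists (Psi : H -> 'I_m -> dual (LUC A)) (T : 'I_m -> dual A),
    [/\ forall l i, X i (Psi l i),
        forall i, bounded_fun (Psi ^~ i) &
        forall l, S l = \sum_(i < m) LUC_dual_act (Psi l i) (T i)].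

Record directed (L : Type) (le : L -> L -> Prop) : Prop := Directed {
  directed_refl : forall l, le l l;
  directed_trans : forall l1 l2 l3, le l1 l2 -> le l2 l3 -> le l1 l3;
  directed_ub : forall l1 l2, exists2 l, le l1 l & le l2 l
}.

Definition tails (L : Type) (le : L -> L -> Prop) : set_system L :=
  filter_from [set: L] (fun l0 => [set l | le l0 l]).

Definition card_weak_star_continuous (R : realType) (k : scalar_kind)
    (H : Type) (E : normedModType (scalars R k)) (Psi : dual (dual E)) : Prop :=
  forall (L : Type) (le : L -> L -> Prop), directed le ->
  infinite_set [set: L] -> ([set: L] #<= [set: H])%card ->
  forall S : L -> dual E, (forall l, `|S l| <= 1) ->
  (S : L -> weak_star E) @ tails le --> ((0 : dual E) : weak_star E) ->
  (Psi (S l) : scalars R k) @[l --> tails le] --> (0 : scalars R k).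

Definition Mazur_property (R : realType) (k : scalar_kind)
    (H : Type) (E : normedModType (scalars R k)) : Prop :=
  forall Psi : dual (dual E), card_weak_star_continuous H Psi ->
  range (@to_bidual R k E) Psi.

(* Main.v *)
(** If [Psi] lies in the topological centre and [S_l -> 0] weak*, factor
    [S_l = \sum_i Phi_(l,i) . T_i] with [Phi_(l,i)] bounded in the subsemigroup.
    Along an ultrafilter refining the net, Banach-Alaoglu gives weak* limits
    [Phi_(l,i) -> Theta_i], and [\sum_i Theta_i . T_i] is the weak* limit of
    [S_l], that is, [0]. Since [Phi |-> Psi Phi] is weak* continuous,
    [<Psi, S_l> = \sum_i <Psi Phi_(l,i), T_i>] tends to
    [\sum_i <Psi Theta_i, T_i> = <Psi, \sum_i Theta_i . T_i> = 0], so the Mazur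
    property puts [Psi] in [A]. *)

Require Import Defs.
From mathcomp Require Import all_boot all_order all_algebra.
From mathcomp Require Import complex.
From mathcomp Require Import all_classical all_reals.
From mathcomp Require Import topology normedtype.

Import Order.TTheory GRing.Theory Num.Theory.
Import numFieldNormedType.Exports.
Local Open Scope classical_set_scope.
Local Open Scope ring_scope.

(** * Ultrafilters *)

Lemma ultra_fmap (T U : Type) (f : T -> U) (F : set_system T) :
  UltraFilter F -> UltraFilter (f @ F).
Proof.
move=> FU; split=> [|G PG sFG].
  exact: fmap_proper_filter.
apply/seteqP; split=> [B GB|]; last exact: sFG.
have [//|FnB] := in_ultra_setVsetC (f @^-1` B) FU.
have GnB : G (~` B) by apply: sFG.
by have [] := filter_ex (filterI GB GnB) => ? [].
Qed.

(** Otherwise the trace of [F] on the complement of [N] is proper, and an ultrafilter refining it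
    contains both [N] and its complement. *)
Lemma ultra_near (T : Type) (F : set_system T) (N : set T) : Filter F ->
  (forall G, UltraFilter G -> F `<=` G -> G N) -> F N.
Proof.
move=> FF FN; apply: contrapT => nFN.
have PF : ProperFilter (within (~` N) F).
  split; last exact: within_filter.
  move=> FN0; apply: nFN; apply: (@filterS _ F FF _ _ _ FN0) => x.
  exact: contrapT.
have [G [GU sFG]] := ultraFilterLemma PF.
have GN : G N.
  by apply: FN => B FB; apply: sFG; exact: (@cvg_within _ F FF _ B FB).
have GnN : G (~` N) by apply: sFG; exact: withinT.
by have [] := filter_ex (filterI GN GnN) => ? [].
Qed.

(** * Convergence of bounded ultrafilters of scalars *)

Lemma real_ultra_cvg (R : realType) (F : set_system R) (M : R) :
  UltraFilter F -> F [set x | `|x| <= M] -> exists x : R, F --> x.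
Proof.
move=> FU FM; have /= := @segment_compact R (- M) M.
rewrite compact_ultra => /(_ F FU)[|x [_ Fx]]; last by exists x.
by apply: filterS FM => x /=; rewrite in_itv /= ler_norml.
Qed.

Lemma ler_normc_ReIm (R : realType) (z : complex R) :
  `|z| <= (`|complex.Re z| + `|complex.Im z|)%:C%C.
Proof.
rewrite normc_def lecR -[leRHS]ger0_norm ?addr_ge0// -sqrtr_sqr ler_wsqrtr//.
by rewrite sqrrD !real_normK ?num_real// lerD2r lerDl mulrn_wge0 ?mulr_ge0.
Qed.

Lemma complex_ultra_cvg (R : realType) (C := complex R : numFieldType)
    (F : set_system C) (M : R) :
  UltraFilter F -> F [set z | `|z| <= M%:C%C] -> exists z : C, F --> z.
Proof.
move=> FU FM.
have [z1 Fz1] : exists x : R, (@complex.Re R) @ F --> x.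
  apply: (@real_ultra_cvg _ _ M); first exact: ultra_fmap.
  apply: (@filterS _ F _ _ _ _ FM) => z /= zM.
  by have := le_trans (normc_ge_Re z) zM; rewrite lecR.
have [z2 Fz2] : exists x : R, (@complex.Im R) @ F --> x.
  apply: (@real_ultra_cvg _ _ M); first exact: ultra_fmap.
  apply: (@filterS _ F _ _ _ _ FM) => z /= zM.
  rewrite -lecR (le_trans _ zM)// normc_def lecR.
  by rewrite -sqrtr_sqr ler_wsqrtr// lerDr sqr_ge0.
exists (Complex z1 z2); apply/(@cvgrPdist_le _ _ _ F _ id) => -[e e'].
(* In the order on complex numbers a positive radius is real, so its imaginary part [e'] vanishes
   and [e / 2] is available for each coordinate. *)
rewrite ltcE /= => /andP[/eqP -> e0].
have e20 : 0 < e / 2 by rewrite divr_gt0.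
have /cvgrPdist_le/(_ _ e20) F1 := Fz1.
have /cvgrPdist_le/(_ _ e20) F2 := Fz2.
apply: filterS2 F1 F2 => -[x y] /= x1 y2.
have := @ler_normc_ReIm R (Complex (z1 - x) (z2 - y)).
move=> /le_trans; apply.
by rewrite lecR /= [leRHS](splitr e) lerD.
Qed.

Lemma scalars_ultra_cvg (R : realType) (k : scalar_kind)
    {F : set_system (scalars R k)} (M : scalars R k) : UltraFilter F ->
  F [set z | `|z| <= M] -> exists z : scalars R k, F --> z.
Proof.
case: k F M => /= F M FU FM; first exact: real_ultra_cvg FM.
apply: (@complex_ultra_cvg _ _ (complex.Re M)) => //.
apply: filterS FM => z /= zM.
(* [M] bounds a norm, so it is nonnegative, hence equal to its real part. *)
have /ger0_Im M0 : 0 <= (M : complex R) by exact: le_trans zM.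
have -> // : (complex.Re M)%:C%C = M.
by apply/eqP; rewrite eq_complex /= M0 !eqxx.
Qed.

(** * Weak* convergence and Banach-Alaoglu *)

Lemma weak_star_cvgP {R : realType} {k : scalar_kind}
    {E : normedModType (scalars R k)} {T : Type} {F : set_system T}
    {FF : Filter F} (f : T -> dual E) (g : dual E) :
  (f : T -> weak_star E) @ F --> (g : weak_star E) <->
  forall x : E, (f t x : scalars R k) @[t --> F] --> (g x : scalars R k).
Proof.
pose h := fun f : dual E => (f : {ptws E -> scalars R k}).
have PW :=
  @pointwise_cvgP E (scalars R k) ((h \o f) @ F) (h g) (fmap_filter _ FF).
split=> [fg x|fg].
  have hfg : (h \o f) @ F --> h g.
    apply: (cvg_comp (f : T -> weak_star E) h fg).
    exact: (@initial_continuous _ _ h g).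
  exact: (PW.1 hfg x).
(* A weak* neighbourhood of [g] contains the preimage under [h] of some [B] open for pointwise
   convergence. *)
move=> A; rewrite nbhsE => -[_ [[B Bop <-] Bg] sBA].
have FB := PW.2 fg B (open_nbhs_nbhs (conj Bop Bg)).
by apply: (@filterS _ F FF _ _ _ FB) => t; exact: sBA.
Qed.

(** Banach-Alaoglu in ultrafilter form: at each [x] the values form a bounded ultrafilter of
    scalars, which converges; the pointwise limit is linear and keeps the bound [M]. *)
Lemma dual_ultra_cvg {R : realType} {k : scalar_kind}
    {E : normedModType (scalars R k)} {T : Type} {F : set_system T}
    (f : T -> dual E) (M : scalars R k) : UltraFilter F ->
  (forall t, `|f t| <= M) ->
  exists g : dual E, (f : T -> weak_star E) @ F --> (g : weak_star E).
Proof.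
move=> FU fM.
have fxM t x : `|f t x| <= M * `|x|.
  by rewrite (le_trans (ler_norm_dual _ _))// ler_wpM2r.
have /choice[g fg] x : exists z : scalars R k,
    (f t x : scalars R k) @[t --> F] --> z.
  apply: (@scalars_ultra_cvg _ _ _ (M * `|x|)); first exact: ultra_fmap.
  by apply: (@filterS _ F _ _ _ _ filterT) => t _; exact: fxM.
have lg : linear (g : E -> (scalars R k)^o).
  move=> c x y; apply: (@cvg_unique _ (@norm_hausdorff _ _) _ _ _ _ (fg _)).
  have -> : (fun t => f t (c *: x + y)) = (fun t => c * f t x + f t y).
    by apply/funext => t; rewrite linearP.
  by apply: cvgD (fg y); apply: cvgM (fg x); exact: cvg_cst.
have gM x : `|g x| <= M * `|x|.
  apply/ler_addgt0Pr => e e0.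
  have /cvgrPdist_le/(_ e e0) FN := fg x.
  have [t /= gt] := @filter_ex _ F _ _ FN.
  rewrite -[X in `|X|](subrK (f t x)) (le_trans (ler_normD _ _))//.
  by rewrite [leRHS]addrC lerD.
exists (Dual (bounded_linear_dual lg gM)); exact/weak_star_cvgP.
Qed.

(** * Index sets of nets *)

(** Serves to turn a net indexed by [T] into a family indexed by [U], by composing with [g], and to
    recover it through [f]. *)
Lemma card_le_retract {T U : Type} : [set: T] !=set0 ->
  ([set: T] #<= [set: U])%card ->
  exists (f : T -> U) (g : U -> T), cancel f g.
Proof.
move=> [t0 _] /card_leP[f].
pose h t : U := val (f (SigSub (mem_setT t))).
have h_inj : injective h.
  move=> s t /val_inj /(inj (mem_setT _) (mem_setT _)).
  by move=> /(congr1 val).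
have /choice[g gP] u : exists t, forall s, h s = u -> s = t.
  have [[t <-]|nh] := pselect (exists t, h t = u).
    by exists t => s /h_inj.
  (* Off the range of [h], the left inverse takes the default value [t0]. *)
  by exists t0 => s hs; case: nh; exists s.
by exists h, g => t; rewrite -(gP (h t) t).
Qed.

Lemma tails_proper {L : Type} {le : L -> L -> Prop} :
  directed le -> [set: L] !=set0 -> ProperFilter (tails le).
Proof.
move=> [lxx ltr lub] L0; apply: filter_from_proper; last first.
  by move=> l _; exists l; exact: lxx.
apply: filter_from_filter => [|i j _ _].
  by case: L0 => l _; exists l.
have [l il jl] := lub i j; exists l => // x /= lx.
by split; apply: ltr lx.
Qed.

Lemma bounded_funP {R : realType} {k : scalar_kind} {T : Type}
    {V : normedModType (scalars R k)} {f : T -> V} :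
  bounded_fun f -> exists M : scalars R k, forall t, `|f t| <= M.
Proof.
move=> [M [Mreal fM]]; exists (`|M| + 1) => t; apply: fM => //.
by rewrite (le_lt_trans (real_ler_norm Mreal))// ltrDl.
Qed.

Lemma dual_sumE (R : realType) (k : scalar_kind)
    (E : normedModType (scalars R k)) (I : finType) (f : I -> dual E) (x : E) :
  (\sum_i f i) x = \sum_i f i x.
Proof. exact: (linear_sum (to_bidual x)). Qed.

(** Since [<a Phi, S> = <Phi, S . a>], each coordinate of the product is evaluation of [Phi] at a
    fixed functional. *)
Lemma arens_weak_star_continuous (R : realType) (k : scalar_kind)
  (A : banachAlgType (scalars R k)) (a : A) :
  continuous (first_arens (to_bidual a) :
     weak_star (dual A) -> weak_star (dual A)).
Proof.
move=> Phi; have FF := @nbhs_filter (weak_star (dual A)) Phi.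
apply/(@weak_star_cvgP _ _ _ _ _ FF) => S.
have /(@weak_star_cvgP _ _ _ _ _ FF) idP :
    (id : dual (dual A) -> weak_star (dual A)) @
      nbhs (Phi : weak_star (dual A)) --> (Phi : weak_star (dual A)).
  exact: cvg_id.
exact: (idP (dual_act S a)).
Qed.

(** The action pairs [Phi] only with functionals [S . a], all of which lie in [LUC A]. *)
Lemma bidual_act_ext (R : realType) (k : scalar_kind)
    (A : banachAlgType (scalars R k)) (Psi : dual (LUC A))
    (Phi : dual (dual A)) :
  (forall f : LUC A, Phi (closed_span_val f) = Psi f) ->
  forall S, bidual_act Phi S = LUC_dual_act Psi S.
Proof.
by move=> PhiPsi S; apply: dualP => a; exact: (PhiPsi (LUC_act_pt S a)).
Qed.

(** * From factorization to weak* continuity along nets *)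

Section factorization_consequences.
Context (R : realType) (k : scalar_kind) (A : banachAlgType (scalars R k))
  (eta : Type) (m : nat) (X : 'I_m -> set (dual (LUC A)))
  (A_factorization : factorization_property eta X)
  (ext : dual (LUC A) -> dual (dual A))
  (ext_restr : forall Psi, (\bigcup_i X i) Psi ->
     forall f : LUC A, ext Psi (closed_span_val f) = Psi f)
  (ext_norm : forall Psi, (\bigcup_i X i) Psi -> `|ext Psi| = `|Psi|)
  (S : set (dual (dual A))) (S_closed : @closed (weak_star (dual A)) S)
  (ext_S : ext @` (\bigcup_i X i) `<=` S).

(** The net is reindexed over [eta], factored there and pulled back. Passing to the extensions
    changes neither the actions nor the norms. *)
Lemma net_factorization {L : Type} {f : L -> dual A} (M : scalars R k) :
  [set: L] !=set0 -> ([set: L] #<= [set: eta])%card ->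
  (forall l, `|f l| <= M) ->
  exists (Phi : L -> 'I_m -> dual (dual A)) (T : 'I_m -> dual A),
    [/\ forall l i, S (Phi l i),
        exists N : 'I_m -> scalars R k, forall l i, `|Phi l i| <= N i &
        forall l, f l = \sum_(i < m) bidual_act (Phi l i) (T i)].
Proof.
move=> L0 /(card_le_retract L0)[u [v uvK]] fM.
have fvb : bounded_fun (f \o v).
  exists M; split => [|N MN e _]; last by exact: le_trans (fM _) (ltW MN).
  by case: L0 => l _; rewrite ger0_real// (le_trans _ (fM l)).
have [Psi [T [PsiX Psib fE]]] := A_factorization _ fvb.
have XPsi l i : (\bigcup_i X i) (Psi l i) by exists i.
exists (fun l i => ext (Psi (u l) i)), T; split=> [l i||l].
- by apply: ext_S; exists (Psi (u l) i).
- have /choice[N NP] i : exists N : scalars R k, forall e, `|Psi e i| <= N.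
    exact: (bounded_funP (Psib i)).
  by exists N => l i; rewrite ext_norm.
- rewrite -[in LHS](uvK l) [LHS]fE; apply: eq_bigr => i _.
  by rewrite (@bidual_act_ext _ _ _ (Psi (u l) i))//; exact: ext_restr.
Qed.

Lemma T1Z_card_weak_star_continuous (Psi : dual (dual A)) :
  T1Z S Psi -> card_weak_star_continuous eta Psi.
Proof.
move=> [_ /subspace_continuousP Psi_cont] L le ledir Linf Lcard f f1 f0.
have L0 : [set: L] !=set0 by exact: infinite_setN0.
have [Phi [T [PhiS [N PhiN] fE]]] := net_factorization _ L0 Lcard f1.
have PF := tails_proper ledir L0.
move=> U U0; apply: (@ultra_near L (tails le) ((Psi \o f) @^-1` U)) => G GU sG.
have /choice[Theta PhiTheta] i : exists Theta : dual (dual A),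
    (Phi ^~ i : L -> weak_star (dual A)) @ G --> (Theta : weak_star (dual A)).
  by apply: (dual_ultra_cvg _ (N i)).
(* The limits must lie in [S], as continuity of [Phi |-> Psi Phi] is known only there. *)
have ThetaS i : S (Theta i).
  apply: (@closed_cvg _ _ G _ _ _ S_closed _ _ (PhiTheta i)).
  exact: nearW.
have sumTheta0 : \sum_(i < m) bidual_act (Theta i) (T i) = 0.
  apply: dualP => a.
  have /weak_star_cvgP/(_ a) fa0 := f0.
  have fGa : (f l a : scalars R k) @[l --> G] --> (0 : scalars R k).
    by move=> B /fa0 /sG.
  (* Both sides are limits of [f l a] along [G]. *)
  apply/esym; apply: (@cvg_unique _ (@norm_hausdorff _ _) _ _ _ _ fGa).
  have -> : (fun l => f l a) =
      (fun l => \sum_(i < m) Phi l i (dual_act (T i) a)).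
    by apply/funext => l; rewrite fE dual_sumE.
  rewrite dual_sumE; apply: cvg_big => [|i _]; first exact: add_continuous.
  exact: ((weak_star_cvgP _ _).1 (PhiTheta i)).
have PsiTheta i : (first_arens Psi (Phi l i) (T i) : scalars R k) @[l --> G] -->
    (first_arens Psi (Theta i) (T i) : scalars R k).
  apply: ((weak_star_cvgP _ _).1 _ (T i)).
  (* Continuity within [S] controls only points of [S]; [PhiS] says that every [Phi l i] is one. *)
  move=> B /(Psi_cont _ (ThetaS i)) /PhiTheta GB.
  apply: (@filterS _ G _ _ _ _ GB) => l; apply; exact: PhiS.
have sumPsi0 : \sum_(i < m) first_arens Psi (Theta i) (T i) = 0.
  by rewrite -[RHS](linear0 Psi) -sumTheta0 linear_sum.
suff : (Psi (f l) : scalars R k) @[l --> G] --> (0 : scalars R k) by exact.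
rewrite -[X in _ --> X]sumPsi0.
have -> : (fun l => Psi (f l)) =
    (fun l => \sum_(i < m) first_arens Psi (Phi l i) (T i)).
  by apply/funext => l; rewrite fE linear_sum.
by apply: cvg_big => [|i _]; [exact: add_continuous | exact: PsiTheta].
Qed.

End factorization_consequences.

Theorem theorem3p5 (R : realType) (k : scalar_kind)
    (A : banachAlgType (scalars R k))
    (eta : Type) (eta_infinite : infinite_set [set: eta])
    (m : nat) (X : 'I_m -> set (dual (LUC A)))
    (X_card : forall i, ([set: eta] #<= X i)%card)
    (A_Mazur : Mazur_property eta A)
    (A_factorization : factorization_property eta X)
    (ext : dual (LUC A) -> dual (dual A))
    (ext_restr : forall Psi, (\bigcup_i X i) Psi ->
       forall f : LUC A, ext Psi (closed_span_val f) = Psi f)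
    (ext_norm : forall Psi, (\bigcup_i X i) Psi -> `|ext Psi| = `|Psi|) :
  (forall S : set (dual (dual A)),
     @closed (weak_star (dual A)) S ->
     first_arens_subsemigroup S ->
     ext @` (\bigcup_i X i) `<=` S ->
     T1Z S = S `&` range (@to_bidual R k A)) /\
  left_strongly_Arens_irregular A.
Proof.
(* Both conclusions are instances of this equality, the second with the whole bidual as [S]. *)
have T1ZE S : @closed (weak_star (dual A)) S -> ext @` (\bigcup_i X i) `<=` S ->
    T1Z S = S `&` range (@to_bidual R k A).
  move=> S_closed ext_S; apply/seteqP; split=> Psi.
    move=> TPsi; split; first by case: TPsi.
    apply: A_Mazur.
    exact: (T1Z_card_weak_star_continuous _ _ _ _ _ _ A_factorization
      ext ext_restr ext_norm S).
  (* Multiplication by an element of [A] is weak* continuous on the whole bidual, so also within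
     [S]. *)
  move=> [SPsi [a _ aPsi]]; split=> //; rewrite -aPsi.
  exact/continuous_subspaceT/arens_weak_star_continuous.
split=> [S S_closed _|]; first exact: T1ZE.
by rewrite /left_strongly_Arens_irregular T1ZE ?setTI//; exact: closedT.
Qed.
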